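(* For every stream $s$: $\mathcal{F}\,(\mathcal{G}\,\mathit{blue})\,s$ if and only if the set $\mathcal{R}_s$ of red positions of $s$ is enumerated, i.e. $\mathit{enum}\,\mathcal{R}_s$.
   Context: The statement is to be proved constructively (intuitionistic type theory with inductive and coinductive definitions; no excluded middle, no Markov's principle). A color is one of $R$ (red), $B$ (blue). A stream is an element of the coinductive type whose only constructor forms $c\,s$ from a color $c$ and a stream $s$; streams are considered up to bisimilarity (equivalently, functions $\mathbb{N}\to\{R,B\}$ up to pointwise equality). $s@n$ denotes the color of $s$ at position $n$ (positions start at $0$), and $\mathcal{R}_s=\{n\in\mathbb{N}\mid s@n=R\}$. $\mathit{blue}\,s$ means that $s=B\,s'$ for some $s'$. For a stream predicate $X$: $\mathcal{F}\,X$ is defined inductively by the rules: $X\,s$ implies $\mathcal{F}\,X\,s$; $\mathcal{F}\,X\,s$ implies $\mathcal{F}\,X\,(c\,s)$ for any color $c$. $\mathcal{G}\,X$ is defined coinductively by the rule: $X\,(c\,s)$ and $\mathcal{G}\,X\,s$ imply $\mathcal{G}\,X\,(c\,s)$. For a set $A$, $\mathit{enum}\,A$ is defined inductively by the rules: if $A$ has no elements then $\mathit{enum}\,A$; if $x\in A$ and $\mathit{enum}\,(A\setminus\{x\})$ then $\mathit{enum}\,A$. Sets considered are decidable sets of natural numbers. *)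

(* Defs.v *)
From Stdlib Require Export Streams.
From Stdlib Require Import PeanoNat.

Inductive color : Set := R | B.

(* The stream modalities "eventually" (F, inductive) and "always"
   (G, coinductive) are [Exists] and [ForAll] of [Streams]: their rules are
   those of F and G written with [tl s] for the tail of [Cons c s]. *)

Definition blue (s : Stream color) : Prop := exists s', s = Cons B s'.

Definition red_positions (s : Stream color) : nat -> Prop :=
  fun n => Str_nth n s = R.

Definition remove (A : nat -> Prop) (x : nat) : nat -> Prop :=
  fun y => A y /\ y <> x.

Inductive enum (A : nat -> Prop) : Prop :=
  | enum_empty : (forall x, ~ A x) -> enum A
  | enum_remove : forall x, A x -> enum (remove A x) -> enum A.

(* [enum] is meant for decidable sets.  By the next two lemmas, every set
   reached from [red_positions s] by removing elements is decidable. *)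

Lemma red_positions_dec (s : Stream color) (n : nat) :
  {red_positions s n} + {~ red_positions s n}.
Proof. unfold red_positions; decide equality. Defined.

Lemma remove_dec (A : nat -> Prop) (x : nat) :
  (forall y, {A y} + {~ A y}) -> forall y, {remove A x y} + {~ remove A x y}.
Proof.
  intros dec y; unfold remove.
  destruct (dec y) as [Ay | nAy]; [destruct (Nat.eq_dec y x) | ]; tauto.
Defined.

(* Main.v *)
(** Both sides say that the red positions are bounded: [enum A] bounds [A] by
    taking the maximum of the elements removed, and conversely a decidable
    bounded set is enumerated by testing the positions below the bound one by
    one, which needs no excluded middle. *)

Require Import Defs.
From Stdlib Require Import Streams.
From Stdlib Require Import PeanoNat Lia.

Definition bounded_by (A : nat -> Prop) (N : nat) : Prop :=
  forall x, A x -> x < N.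

Lemma enum_bounded (A : nat -> Prop) : enum A -> exists N, bounded_by A N.
Proof.
  induction 1 as [A empty | A x Ax _ [N HN]].
  - exists 0. intros x Ax. destruct (empty x Ax).
  (* Bounds are strict, so the removed [x] contributes [S x]; any other element of [A] survives in
     [remove A x], hence lies below [N]. *)
  - exists (Nat.max N (S x)). intros y Ay.
    destruct (Nat.eq_dec y x) as [-> | ne]; [lia | ].
    specialize (HN y (conj Ay ne)). lia.
Qed.

(** The induction keeps [A] general, since testing the largest candidate position may replace [A] by
    [remove A N]. *)
Lemma bounded_enum (N : nat) (A : nat -> Prop) :
  (forall x, {A x} + {~ A x}) -> bounded_by A N -> enum A.
Proof.
  revert A. induction N as [ | N IH]; intros A dec HA.
  - apply enum_empty. intros x Ax. specialize (HA x Ax). lia.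
  - destruct (dec N) as [AN | nAN].
    + apply enum_remove with N; [exact AN | ].
      apply IH; [exact (remove_dec A N dec) | ].
      intros y [Ay ne]. specialize (HA y Ay). lia.
    + apply IH; [exact dec | ].
      intros y Ay. specialize (HA y Ay).
      assert (y <> N) by (intros ->; exact (nAN Ay)). lia.
Qed.

Lemma blue_not_red (s : Stream color) : blue s <-> ~ red_positions s 0.
Proof.
  unfold red_positions, Str_nth. destruct s as [[] s]; simpl; split.
  - intros [s' [=]].
  - intros []; reflexivity.
  - discriminate.
  - intros _. exists s. reflexivity.
Qed.

Lemma ForAll_blue_no_red (s : Stream color) :
  ForAll blue s -> forall n, ~ red_positions s n.
Proof.
  (* [red_positions (Str_nth_tl n s) 0] is convertible to [red_positions s n]. *)
  intros H n. apply (blue_not_red (Str_nth_tl n s)).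
  destruct (ForAll_Str_nth_tl n H) as [Hb _]. exact Hb.
Qed.

Lemma no_red_ForAll_blue (s : Stream color) :
  (forall n, ~ red_positions s n) -> ForAll blue s.
Proof.
  revert s. cofix CH. intros s H. constructor.
  - apply blue_not_red. exact (H 0).
  (* Position [n] of [tl s] is position [S n] of [s] by computation. *)
  - apply CH. intros n. exact (H (S n)).
Qed.

(** A bound [N] matches a derivation with [N] uses of [Further]: each passage to the tail shifts
    positions down by one, and [Here] matches the bound 0, which leaves no red position. *)
Lemma Exists_ForAll_blue_bounded (s : Stream color) :
  Exists (ForAll blue) s <-> exists N, bounded_by (red_positions s) N.
Proof.
  split.
  - induction 1 as [s H | s _ [N HN]].
    + exists 0. intros n red. destruct (ForAll_blue_no_red s H n red).
    + exists (S N). intros [ | n] red; [lia | ].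
      specialize (HN n red). lia.
  - intros [N HN]. revert s HN. induction N as [ | N IH]; intros s HN.
    + apply Here, no_red_ForAll_blue. intros n red.
      specialize (HN n red). lia.
    + apply Further, IH. intros n red. specialize (HN (S n) red). lia.
Qed.

Theorem lemma5p1 (s : Stream color) :
  Exists (ForAll blue) s <-> enum (red_positions s).
Proof.
  rewrite Exists_ForAll_blue_bounded. split.
  - intros [N HN]. exact (bounded_enum N _ (red_positions_dec s) HN).
  - exact (enum_bounded _).
Qed.
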